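(* Let $N\geq 1$, $p>1$, let $L(x,\nabla)$ be a linear differential operator on $\mathbb{R}^N$ of order $m$, and let $f\in L^\infty_{\mathrm{loc}}(\mathbb{R}^N)$ with $f(x)>0$ a.e. Assume there exists $g$ with $g(x)>0$ a.e. such that, setting $D=gL$, the formal adjoint $D^*$ is a differential operator with $L^\infty_{\mathrm{loc}}$ coefficients and no zero order term, i.e. \[ D^*(x,\nabla)=\sum_{1\leq|\alpha|\leq m}a_\alpha(x)\partial_x^\alpha,\qquad a_\alpha\in L^\infty_{\mathrm{loc}}(\mathbb{R}^N). \] Let $u\in L^1_{\mathrm{loc}}(\mathbb{R}^N)$ with $fg|u|^p\in L^1_{\mathrm{loc}}(\mathbb{R}^N)$ be a global $g$-solution of $Lu=f|u|^p$, i.e. \[ \int_{\mathbb{R}^N}f(x)g(x)|u(x)|^p\phi(x)\,dx=\int_{\mathbb{R}^N}u(x)\,D^*(x,\nabla)\phi(x)\,dx\qquad\text{for all }\phi\in\mathcal{C}^\infty_c(\mathbb{R}^N). \] Suppose there exist strictly increasing continuous functions $F_i:(0,\infty)\to(0,\infty)$, $i=1,\dots,N$, with $F_i(R)\to\infty$ as $R\to\infty$, such that \[ \limsup_{R\to\infty}H_\alpha(R)\,G_\alpha(R)^{1/p'}<\infty\qquad\text{for every }1\leq|\alpha|\leq m, \] where $p'=p/(p-1)$, \[ H_\alpha(R)=\prod_{i=1}^NF_i(R)^{-\alpha_i},\qquad G_\alpha(R)=\int_{Q_R^{(\alpha)}}|a_\alpha(x)|^{p'}\,(g(x)f(x))^{-(p'-1)}\,dx\in[0,\infty],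 \] and $Q_R^{(\alpha)}=\{x\in\mathbb{R}^N:\ |x_i|\leq F_i(R)\ \forall i,\ \ |x_i|\geq F_i(R)/2\text{ for every }i\text{ with }\alpha_i\neq0\}$. Then $u(x)=0$ a.e.
   Context: The formal adjoint $D^*$ of a differential operator $D$ is defined by $\int vDu\,dx=\int u D^*v\,dx$ for all $u,v\in\mathcal{C}^\infty_c(\mathbb{R}^N)$. *)

(* Defs.v *)
From HB Require Import structures.
From mathcomp Require Import all_boot all_order all_algebra.
From mathcomp Require Import all_classical all_reals all_analysis.
Set Implicit Arguments. Unset Strict Implicit. Unset Printing Implicit Defensive.
Import Order.TTheory GRing.Theory Num.Theory.
Import numFieldNormedType.Exports.
Local Open Scope classical_set_scope.
Local Open Scope ring_scope.

(* Points of R^N are represented as N.-tuple R; this type carries the library's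
   product (= Borel) sigma-algebra generated by the coordinate projections. *)

Section Defs.
Variables (R : realType) (N : nat).

Definition is_lebesgue_measureN (mu : {measure set (N.-tuple R) -> \bar R}) :=
  forall a b : N.-tuple R, (forall i, tnth a i <= tnth b i) ->
  mu [set x | forall i, tnth a i <= tnth x i <= tnth b i] =
  (\prod_(i < N) (tnth b i - tnth a i))%:E.

Definition cube (r : R) : set (N.-tuple R) :=
  [set x | forall i, `|tnth x i| <= r].

Definition L1loc (mu : {measure set (N.-tuple R) -> \bar R}) (h : N.-tuple R -> R) :=
  measurable_fun setT h /\ forall r : R, mu.-integrable (cube r) (EFin \o h).

Definition Linfloc (mu : {measure set (N.-tuple R) -> \bar R}) (h : N.-tuple R -> R) :=
  measurable_fun setT h /\
  forall r : R, exists M : R, {ae mu, forall x, cube r x -> `|h x| <= M}.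

Definition tup2row (x : N.-tuple R) : 'rV[R]_N := \row_i tnth x i.
Definition row2tup (v : 'rV[R]_N) : N.-tuple R := [tuple v ord0 i | i < N].

Definition pd (i : 'I_N) (phi : N.-tuple R -> R) : N.-tuple R -> R :=
  fun x => derive (phi \o row2tup) (tup2row x) (delta_mx ord0 i).

Definition smooth (phi : N.-tuple R -> R) :=
  forall s : seq 'I_N,
    continuous (foldr pd phi s \o row2tup) /\
    forall (i : 'I_N) (v : 'rV[R]_N), derivable (foldr pd phi s \o row2tup) v (delta_mx ord0 i).

Definition test_fun (phi : N.-tuple R -> R) :=
  smooth phi /\ exists M : R, forall x, (exists i, M < `|tnth x i|) -> phi x = 0.

Definition multi_index (m : nat) := {ffun 'I_N -> 'I_m.+1}.
Definition mi_size m (al : multi_index m) : nat := (\sum_(i < N) (al i : nat))%N.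

Definition dalpha m (al : multi_index m) (phi : N.-tuple R -> R) : N.-tuple R -> R :=
  foldr (fun i psi => iter (al i) (pd i) psi) phi (enum 'I_N).

Definition diff_op (lo m : nat) (c : multi_index m -> N.-tuple R -> R)
    (phi : N.-tuple R -> R) : N.-tuple R -> R :=
  fun x => \sum_(al : multi_index m | (lo <= mi_size al <= m)%N) c al x * dalpha al phi x.

End Defs.

(* Main.v *)
(* Test the equation against phi(x) = prod_i W(x_i / F_i(r)), where W is a
   smooth cutoff equal to 1 on [-1/2, 1/2], supported in [-1, 1] and such that
   |W^(j)| <= C W^(1/p) for j <= m; a large power of any smooth cutoff has this
   last property.  The derivative of phi of order alpha <> 0 lives on the shell
   Q_r^(alpha), so Hoelder's inequality and the bound on H_alpha G_alpha^(1/p')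
   give, for w = f g |u|^p and all large r,
     int w phi <= K (int_B w phi)^(1/p)   whenever B contains all the shells.
   B = R^N shows that w is integrable; B = the complement of a large cube then
   makes the right-hand side a tail of a convergent integral, so int w = 0. *)
Require Import Defs.
From HB Require Import structures.
From mathcomp Require Import all_boot all_order all_algebra.
From mathcomp Require Import all_classical all_reals all_analysis.
From mathcomp Require Import measurable_realfun.
From mathcomp Require Import lra ring.
Import Order.TTheory GRing.Theory Num.Theory.
Import numFieldNormedType.Exports.
Local Open Scope classical_set_scope.
Local Open Scope ring_scope.

(** * Smooth functions of one variable *)

Section Smooth1.
Context {R : realType}.
Implicit Types f g : R -> R.

(** Only differentiability is asked for, not continuity of the last derivative; this keeps the
    inductions short, and over all [n] the two notions agree. *)
Fixpoint Ck (n : nat) f : Prop :=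
  if n is n'.+1 then (forall x, derivable f x 1) /\ Ck n' f^`()%classic
  else True.

Definition smooth1 f := forall n, Ck n f.

Lemma CkW n f : Ck n.+1 f -> Ck n f.
Proof.
elim: n f => [//|n ih] f [df cf]; split => //; exact: ih.
Qed.

Lemma Ck_cst n (c : R) : Ck n (fun=> c).
Proof.
elim: n c => [//|n ih] c; split=> [x|]; first exact: derivable_cst.
rewrite (_ : _^`()%classic = fun=> (0 : R)); first exact: ih.
by apply/funext => x; rewrite derive1E derive_cst.
Qed.

Lemma Ck_id n : Ck n (id : R -> R).
Proof.
case: n => [//|n]; split=> [x|]; first exact: derivable_id.
rewrite (_ : _^`()%classic = fun=> (1 : R)); first exact: Ck_cst.
by apply/funext => x; rewrite derive1E derive_id.
Qed.

Lemma CkD n f g : Ck n f -> Ck n g -> Ck n (fun x => f x + g x).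
Proof.
elim: n f g => [//|n ih] f g [df cf] [dg cg]; split=> [x|].
  exact: derivableD.
rewrite (_ : _^`()%classic = fun x => f^`()%classic x + g^`()%classic x).
  exact: ih.
by apply/funext => x; rewrite !derive1E deriveD.
Qed.

Lemma CkM n f g : Ck n f -> Ck n g -> Ck n (fun x => f x * g x).
Proof.
elim: n f g => [//|n ih] f g cf cg; split=> [x|].
  by apply: derivableM; [case: cf|case: cg].
rewrite (_ : _^`()%classic =
    fun x => f x * g^`()%classic x + g x * f^`()%classic x).
  by apply: CkD; apply: ih; (exact: CkW) || (by case: cf) || (by case: cg).
by apply/funext => x; rewrite !derive1E deriveM//; [case: cf|case: cg].
Qed.

Lemma Ck_comp n f g : Ck n f -> Ck n g -> Ck n (fun x => f (g x)).
Proof.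
elim: n f g => [//|n ih] f g cf cg.
have dfg x : derivable (f \o g) x 1.
  apply/derivable1_diffP/differentiable_comp; apply/derivable1_diffP.
    by case: cg.
  by case: cf.
split; first exact: dfg.
rewrite (_ : _^`()%classic = fun x => f^`()%classic (g x) * g^`()%classic x).
  by apply: CkM; [apply: ih; [case: cf|exact: CkW]|case: cg].
apply/funext => x; rewrite (@derive1_comp _ g f)//.
- by case: cg.
- by case: cf.
Qed.

Lemma smooth1_derivable f x : smooth1 f -> derivable f x 1.
Proof. by move=> /(_ 1%N) []. Qed.

Lemma smooth1_derive1 f : smooth1 f -> smooth1 f^`()%classic.
Proof. by move=> sf n; case: (sf n.+1). Qed.

Lemma smooth1_derive1n n f : smooth1 f -> smooth1 f^`(n)%classic.
Proof.
by elim: n => [//|n ih] /ih; rewrite derive1nS; exact: smooth1_derive1.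
Qed.

Lemma smooth1_continuous f : smooth1 f -> continuous f.
Proof.
move=> sf x; apply: differentiable_continuous.
by apply/derivable1_diffP; exact: smooth1_derivable.
Qed.

Lemma smooth1_cst (c : R) : smooth1 (fun=> c).
Proof. by move=> n; exact: Ck_cst. Qed.

Lemma smooth1_id : smooth1 (id : R -> R).
Proof. by move=> n; exact: Ck_id. Qed.

Lemma smooth1D f g : smooth1 f -> smooth1 g -> smooth1 (fun x => f x + g x).
Proof. by move=> sf sg n; exact: CkD. Qed.

Lemma smooth1M f g : smooth1 f -> smooth1 g -> smooth1 (fun x => f x * g x).
Proof. by move=> sf sg n; exact: CkM. Qed.

Lemma smooth1X f k : smooth1 f -> smooth1 (fun x => f x ^+ k).
Proof.
move=> sf; elim: k => [|k ih]; first exact: smooth1_cst.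
by under eq_fun do rewrite exprS; exact: smooth1M.
Qed.

Lemma smooth1_comp f g : smooth1 f -> smooth1 g -> smooth1 (fun x => f (g x)).
Proof. by move=> sf sg n; exact: Ck_comp. Qed.

(** With s = y/n, the bound is the n-th power of s <= 1 + s <= e^s. *)
Lemma powN_expRN_le n (y : R) : 0 < y -> y ^+ n * expR (- y) <= n%:R ^+ n.
Proof.
case: n => [|n] y0; first by rewrite !expr0 mul1r -expR0 ler_expR oppr_le0 ltW.
have n0 : (0 : R) < n.+1%:R by rewrite ltr0n.
rewrite expRN ler_pdivrMr ?expR_gt0//.
rewrite (_ : y = n.+1%:R * (y / n.+1%:R)); last by rewrite mulrC divfK ?gt_eqF.
rewrite expRM_natl exprMn.
rewrite ler_pM2l ?exprn_gt0// lerXn2r ?nnegrE ?expR_ge0 ?divr_ge0 ?ltW//.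
by apply: lt_le_trans (expR_ge1Dx _); rewrite ltrDr.
Qed.

(* [hflat n t = t^-n e^(-1/t)] for [t > 0]; these span a space stable under
   differentiation, which is how [hflat 0] is shown to be smooth. *)
Definition hflat n (t : R) : R :=
  if 0 < t then t^-1 ^+ n * expR (- t^-1) else 0.

Lemma hflat_ge0 n t : 0 <= hflat n t.
Proof.
rewrite /hflat; case: ifPn => // t0.
by rewrite mulr_ge0 ?expR_ge0 ?exprn_ge0 ?invr_ge0 ?ltW.
Qed.

(** Apply [powN_expRN_le] to y = 1/t with exponent n + 2. The quadratic decay makes the difference
    quotients of [hflat n] at 0 tend to 0. *)
Lemma hflat_quadratic n t : `|hflat n t| <= n.+2%:R ^+ n.+2 * t ^+ 2.
Proof.
rewrite ger0_norm ?hflat_ge0// /hflat; case: ifPn => [t0|_].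
  have /(powN_expRN_le n.+2) : 0 < t^-1 by rewrite invr_gt0.
  set c := _ ^+ _; set e := expR _ => h.
  have -> : t^-1 ^+ n * e = (t^-1 ^+ n.+2 * e) * t ^+ 2.
    by rewrite -addn2 exprD !exprVn; set a := (t ^+ n)^-1; field;
      rewrite gt_eqF.
  by rewrite ler_wpM2r ?sqr_ge0.
by rewrite mulr_ge0 ?sqr_ge0.
Qed.

Lemma is_derive_hflat n (t : R) :
  is_derive t 1 (hflat n) (- n%:R * hflat n.+1 t + hflat n.+2 t).
Proof.
have [t0|t0|->] := ltgtP t 0.
- rewrite {2 3}/hflat ltNge ltW//= mulr0 addr0.
  apply: (@near_eq_is_derive _ _ _ (cst (0 : R))).
  near=> s; rewrite /hflat ltNge ltW//=.
  by near: s; exact: lt_nbhsl.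
- pose g := fun s : R => s^-1 ^+ n * expR (- s^-1).
  apply: (@near_eq_is_derive _ _ _ g).
    near=> s; rewrite /hflat ifT//.
    by near: s; exact: lt_nbhsr.
  have tn0 : t != 0 by rewrite gt_eqF.
  have di : is_derive t 1 (fun y : R => y^-1) (- t ^- 2 *: 1).
    exact: (@is_deriveV _ id).
  have dX : is_derive t 1 (fun y : R => y^-1 ^+ n)
      (n%:R * t^-1 ^+ n.-1 *: (- t ^- 2 *: 1)).
    have := @is_deriveX _ _ _ n _ _ _ di.
    rewrite (_ : _ ^+ n = fun y : R => y^-1 ^+ n)//.
    by apply/funext => y; rewrite fctE.
  have dE : is_derive t 1 (fun y : R => expR (- y^-1))
      (expR (- t^-1) * (- (- t ^- 2 *: 1))).
    exact: (@is_derive1_comp _ expR (fun y => - y^-1)).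
  apply: (is_derive_eq (is_deriveM dX dE)).
  rewrite /hflat t0 /GRing.scale/=.
  (* For n = 0 the truncated [n.-1] is harmless, since the factor n vanishes. *)
  have n1 : n%:R * t^-1 ^+ n.+1 = n%:R * t^-1 ^+ n.-1 * t ^- 2.
    case: (n) => [|k]; first by rewrite !mul0r.
    by rewrite /= -mulrA -exprVn -exprD addn2.
  rewrite mulNr (mulrA n%:R) n1 (_ : t^-1 ^+ n.+2 = t^-1 ^+ n * t ^- 2).
    by ring.
  by rewrite -addn2 exprD (exprVn t 2).
- rewrite {2 3}/hflat ltxx mulr0 addr0.
  have c : (fun h : R => h^-1 *: ((hflat n \o shift 0) (h *: 1) - hflat n 0))
      @ 0^' --> (0 : R).
    apply/cvgrPdist_le => /= e e0.
    set C : R := n.+2%:R ^+ n.+2.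
    have C0 : 0 < C by rewrite exprn_gt0// ltr0n.
    near=> h.
    have h0 : h != 0 by near: h; exact: nbhs_dnbhs_neq.
    rewrite sub0r normrN /= addr0 /GRing.scale/= mulr1.
    rewrite [hflat n 0]/hflat ltxx subr0.
    rewrite normrM normfV ler_pdivrMl ?normr_gt0//.
    apply: (le_trans (hflat_quadratic n h)).
    rewrite -real_normK ?num_real// expr2 mulrCA ler_wpM2l//.
    rewrite -ler_pdivlMl//.
    near: h; apply: dnbhs0_le.
    by rewrite mulr_gt0 ?invr_gt0.
  split; first exact/cvg_ex/(ex_intro _ 0).
  by apply: cvg_lim.
Unshelve. all: by end_near.
Qed.

End Smooth1.

(** * Smooth cutoffs whose derivatives are controlled by a power of the cutoff *)

Section Cutoff.
Context {R : realType}.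
Implicit Types f g : R -> R.

(** The derivative of [hflat n] involves [hflat n.+1] and [hflat n.+2], so the induction on the
    order of differentiability treats all [n] at once. *)
Lemma smooth1_hflat n : smooth1 (@hflat R n).
Proof.
move=> k; elim: k n => [//|k ih] n; split=> [x|].
  by have [] := is_derive_hflat n x.
rewrite (_ : _^`()%classic = fun t => - n%:R * hflat n.+1 t + hflat n.+2 t).
  by apply: CkD => //; apply: CkM => //; exact: Ck_cst.
by apply/funext => t; rewrite derive1E; have [_ ->] := is_derive_hflat n t.
Qed.

Lemma hflat0_le (s t : R) : s <= t -> hflat 0 s <= hflat 0 t.
Proof.
move=> st; have [s0|s0] := ltP 0 s; last first.
  by rewrite {1}/hflat ltNge s0 hflat_ge0.
have t0 := lt_le_trans s0 st.
by rewrite /hflat s0 t0 !expr0 !mul1r ler_expR lerN2 lef_pV2.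
Qed.

Lemma expR_hflat01 : expR 1 * hflat 0 1 = 1 :> R.
Proof. by rewrite /hflat ltr01 expr0 mul1r invr1 expRxMexpNx_1. Qed.

Lemma exists_cutoff : exists V : R -> R, [/\ smooth1 V,
  forall t, 0 <= V t <= 1,
  forall t, `|t| <= 2^-1 -> V t = 1 &
  forall t, 1 <= `|t| -> V t = 0].
Proof.
(* [s <= 0] on [|t| <= 1/2] and [s >= 1] on [|t| >= 1], while [e * hflat 0]
   vanishes on [s <= 0] and is at least [1] on [s >= 1]. *)
pose s (t : R) := 4 / 3 * (t * t + - 4^-1).
have sE t : s t = 4 / 3 * (`|t| ^+ 2 - 4^-1) by rewrite /s real_normK ?num_real.
pose E : R := expR 1.
have E0 : 0 <= E by exact: expR_ge0.
exists (fun t => E * hflat 0 (1 + - E * hflat 0 (s t))); split.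
- apply: smooth1M; first exact: smooth1_cst.
  apply: (@smooth1_comp _ (hflat 0)); first exact: smooth1_hflat.
  apply: smooth1D; first exact: smooth1_cst.
  apply: smooth1M; first exact: smooth1_cst.
  apply: (@smooth1_comp _ (hflat 0)); first exact: smooth1_hflat.
  apply: smooth1M; first exact: smooth1_cst.
  by apply: smooth1D; [apply: smooth1M; exact: smooth1_id|exact: smooth1_cst].
- move=> t; rewrite mulr_ge0 ?hflat_ge0//= -[leRHS]expR_hflat01 ler_wpM2l//.
  by apply: hflat0_le; rewrite mulNr gerBl mulr_ge0 ?hflat_ge0.
- move=> t t2; rewrite {2}/hflat ifF ?mulr0 ?addr0 ?expR_hflat01//.
  apply/negbTE; rewrite -leNgt sE pmulr_rle0//.
  by have := normr_ge0 t; nra.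
- move=> t t1; rewrite {1}/hflat ifF ?mulr0//.
  apply/negbTE; rewrite -leNgt mulNr subr_le0 -[leLHS]expR_hflat01 ler_wpM2l//.
  by apply: hflat0_le; rewrite sE; nra.
Qed.

(** On an open set where f is constant its derivative is the constant 0, and the argument repeats
    there. This confines the derivatives of positive order of a cutoff to 1/2 <= |t| <= 1. *)
Lemma derive1n_near_cst f (c : R) (A : set R) n x : (0 < n)%N -> open A ->
  (forall t, A t -> f t = c) -> A x -> f^`(n)%classic x = 0.
Proof.
move=> + oA fc Ax; case: n => // n _.
have near0 (g : R -> R) (b : R) : (forall t, A t -> g t = b) ->
    forall t, A t -> g^`()%classic t = 0.
  move=> gb t At; rewrite derive1E (@near_eq_derive _ _ _ _ (cst b)).
    by rewrite derive_cst.
  by apply: filterS (open_nbhs_nbhs (conj oA At)).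
elim: n x Ax => [|n ih] x Ax; first by rewrite derive1n1; exact: near0 fc _ Ax.
by rewrite derive1nS; exact: near0 ih _ Ax.
Qed.

(** One differentiation costs one power of V: (V^i q)' = V^(i-1) (i V' q + V q'). *)
Lemma derive1n_expn_factor (V : R -> R) k j : smooth1 V -> (j <= k)%N ->
  exists q, smooth1 q /\
    (fun t => V t ^+ k)^`(j)%classic = (fun t => V t ^+ (k - j) * q t).
Proof.
move=> sV; elim: j => [_|j ih jk].
  exists (fun=> 1); split; first exact: smooth1_cst.
  by apply/funext => t; rewrite derive1n0 subn0 mulr1.
have [q [sq Wq]] := ih (ltnW jk).
have kj : (k - j = (k - j.+1).+1)%N by rewrite subnSK.
exists (fun t => (k - j)%:R * (V^`()%classic t * q t) + V t * q^`()%classic t).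
split.
  apply: smooth1D; last by apply: smooth1M => //; exact: smooth1_derive1.
  apply: smooth1M; first exact: smooth1_cst.
  by apply: smooth1M => //; exact: smooth1_derive1.
rewrite derive1nS Wq; apply/funext => t.
have dV := smooth1_derivable _ t sV; have dq := smooth1_derivable _ t sq.
have dVX : is_derive t 1 (fun y => V y ^+ (k - j))
    (((k - j)%:R * V t ^+ (k - j).-1) *: V^`()%classic t).
  have := @is_deriveX _ _ _ (k - j) _ _ _ (derivableP dV).
  rewrite derive1E (_ : V ^+ _ = fun y : R => V y ^+ (k - j))//.
  by apply/funext => y; rewrite fctE.
rewrite derive1E; have [_ ->] := is_deriveM dVX (derivableP dq).
rewrite -derive1E /GRing.scale/= kj/= exprS; ring.
Qed.

(** Take W = V^k for a cutoff V and a large k. Then |W^(j)| <= C V^(k-j) <= C V^(k/p) = C W^(1/p),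
    because 0 <= V <= 1. *)
Lemma exists_weighted_cutoff (m : nat) (p : R) : 1 < p ->
  exists W : R -> R, [/\ smooth1 W,
  forall t, 0 <= W t <= 1,
  forall t, `|t| <= 2^-1 -> W t = 1,
  forall j t, 1 < `|t| -> W^`(j)%classic t = 0 &
  exists2 C : R, 1 <= C & forall j t, (j <= m)%N ->
    `|W^`(j)%classic t| <=
      C * (W t `^ p^-1) * ((j != 0%N) ==> (2^-1 <= `|t|))%:R].
Proof.
move=> p1; have p0 : 0 < p by rewrite (lt_trans _ p1).
have [V [sV V01 V1 V0]] := exists_cutoff.
have ip : 0 < 1 - p^-1 by rewrite subr_gt0 invf_lt1.
(* This k gives k (1 - 1/p) >= m + 1, hence both k > m and k - j >= k/p for j <= m. *)
pose k := Num.bound (m.+1%:R / (1 - p^-1) : R).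
have kp : (m%:R : R) + 1 <= k%:R * (1 - p^-1).
  rewrite -ler_pdivrMr// natr1 ltW// archi_boundP//.
  by rewrite divr_ge0// ltW.
have mk : (m < k)%N.
  have p'0 : 0 < p^-1 by rewrite invr_gt0.
  have k0 : (0 : R) <= k%:R by [].
  by rewrite -(@ltr_nat R); nra.
pose W t := V t ^+ k.
have supp j t : 1 < `|t| -> W^`(j)%classic t = 0.
  case: j => [|j] t1; first by rewrite /= /W V0 ?ltW// expr0n; case: (k) mk.
  apply: (@derive1n_near_cst W 0 [set t | 1 < `|t|]) => //.
    rewrite (_ : [set _ | _] = Num.norm @^-1` [set y | 1 < y])//.
    by apply: open_comp (@open_gt _ 1); move=> y _; exact: norm_continuous.
  by move=> y /ltW y1; rewrite /W V0// expr0n; case: (k) mk.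
have W01 t : 0 <= W t <= 1.
  by have /andP[? ?] := V01 t; rewrite exprn_ge0// exprn_ile1.
exists W; split => //.
- exact: smooth1X.
- by move=> t /V1 Vt; rewrite /W Vt expr1n.
have bnd j : (j <= m)%N -> exists2 C : R, 1 <= C & forall t,
    `|W^`(j)%classic t| <= C * V t ^+ (k - j).
  move=> jm; have jk := leq_ltn_trans jm mk.
  have [q [sq Wq]] := derive1n_expn_factor _ k j sV (ltnW jk).
  (* The cofactor q is bounded on [-1, 1] by compactness; outside, the derivative vanishes by
     [supp]. *)
  have [||c _ qc] := @EVT_max _ (fun t => `|q t|) (-1) 1; first by lra.
    apply: continuous_subspaceT => t.
    apply: (@continuous_comp _ _ _ q) (@norm_continuous _ _ _).
    exact: smooth1_continuous.
  exists (Num.max 1 `|q c|) => [|t]; first by rewrite le_max lexx.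
  have V0t : 0 <= V t ^+ (k - j) by rewrite exprn_ge0//; case/andP: (V01 t).
  have [t1|t1] := lerP `|t| 1.
    rewrite /W Wq normrM ger0_norm// mulrC ler_wpM2r// le_max qc ?orbT//.
    by rewrite in_itv/= -ler_norml.
  by rewrite supp// normr0 mulr_ge0// le_max ler01.
have [C C1 HC] : exists2 C : R, 1 <= C & forall j t, (j <= m)%N ->
    `|W^`(j)%classic t| <= C * V t ^+ (k - j).
  (* Adding up the constants for the orders 0, ..., m gives one that serves them all. *)
  elim: (m) bnd => [|n ih] bnd.
    by have [C C1 HC] := bnd 0%N erefl; exists C => // j t;
      rewrite leqn0 => /eqP->.
  have [C C1 HC] := ih (fun j jn => bnd j (leqW jn)).
  have [C' C'1 HC'] := bnd n.+1 (leqnn _).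
  exists (C + C') => [|j t].
    by rewrite (le_trans C1)// lerDl (le_trans _ C'1).
  have V0t : 0 <= V t ^+ (k - j) by rewrite exprn_ge0//; case/andP: (V01 t).
  rewrite leq_eqVlt => /predU1P[jn|jn].
    by subst j; rewrite (le_trans (HC' t))// ler_wpM2r// lerDr (le_trans _ C1).
  by rewrite (le_trans (HC _ t _))// ler_wpM2r// lerDl (le_trans _ C'1).
exists C => // j t jm.
have [jt|jt] := boolP ((j != 0%N) ==> _); last first.
  move: jt; rewrite negb_imply -ltNge => /andP[j0 t2].
  rewrite mulr0 (@derive1n_near_cst W 1 [set t | `|t| < 2^-1]) ?normr0 ?lt0n//.
    rewrite (_ : [set _ | _] = Num.norm @^-1` [set y | y < 2^-1])//.
    by apply: open_comp (@open_lt _ _); move=> y _; exact: norm_continuous.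
  by move=> y /ltW y1; rewrite /W V1// expr1n.
rewrite mulr1; apply: (le_trans (HC j t jm)).
rewrite ler_wpM2l ?(le_trans _ C1)//.
have /andP[Vt0 Vt1] := V01 t.
have jk := leq_ltn_trans jm mk.
rewrite /W -!powR_mulrn// -powRrM.
(* At V t = 0 the left side is 0 because j < k keeps its exponent positive; the comparison of powers
   below needs V t > 0. *)
have [->|Vt] := eqVneq (V t) 0.
  by rewrite powR0 ?powR_ge0// pnatr_eq0 subn_eq0 -ltnNge.
apply: ger_powR; first by rewrite lt0r Vt Vt0.
rewrite natrB ?(ltnW jk)//.
have : (j%:R : R) <= m%:R by rewrite ler_nat.
by move: kp; lra.
Qed.

End Cutoff.

(** * Tensor products of rescaled cutoffs *)

Section TensorCutoff.
Context {R : realType} {N : nat}.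

(** Only the i-th factor varies in direction e_i, so the difference quotient is that of [w i] times
    the constant product of the others. *)
Lemma is_derive_prod_coord (w : 'I_N -> R -> R) (v : 'rV[R]_N) (i : 'I_N) :
  derivable (w i) (v ord0 i) 1 ->
  is_derive v (delta_mx ord0 i) (fun x : 'rV[R]_N => \prod_k w k (x ord0 k))
    ((w i)^`()%classic (v ord0 i) * \prod_(k | k != i) w k (v ord0 k)).
Proof.
move=> dw; set P := \prod_(k | k != i) _.
have E : (fun h : R => h^-1 *: (((fun x : 'rV[R]_N => \prod_k w k (x ord0 k))
      \o shift v) (h *: delta_mx ord0 i) - \prod_k w k (v ord0 k))) =
    (fun h : R =>
       h^-1 *: ((w i \o shift (v ord0 i)) (h *: 1) - w i (v ord0 i)) * P).
  apply/funext => h /=.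
  have -> : \prod_k w k ((h *: delta_mx ord0 i + v) ord0 k) =
      w i (h *: 1 + v ord0 i) * P.
    rewrite (bigD1 i)//= !mxE !eqxx; congr (_ * _).
    by apply: eq_bigr => k /negbTE ki; rewrite !mxE ki andbF mulr0 add0r.
  have -> : \prod_k w k (v ord0 k) = w i (v ord0 i) * P by rewrite (bigD1 i).
  by rewrite /GRing.scale/= -mulrBl mulrA.
have c : (fun h : R => h^-1 *: (((fun x : 'rV[R]_N => \prod_k w k (x ord0 k))
      \o shift v) (h *: delta_mx ord0 i) - \prod_k w k (v ord0 k))) @ 0^' -->
    (w i)^`()%classic (v ord0 i) * P.
  rewrite E; apply: cvgM; last exact: cvg_cst.
  by rewrite derive1E; exact: dw.
split; first by apply/cvg_ex; eexists; exact: c.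
by apply: cvg_lim => //; exact: c.
Qed.

(** For smooth W this is the mixed derivative of order [j] of the product of the W(x_k / c_k).
    Carrying the order as a parameter closes the family under [pd]. *)
Definition tensor (W : R -> R) (c : 'I_N -> R) (j : 'I_N -> nat)
  (x : N.-tuple R) : R :=
  \prod_(k < N) (c k ^- j k * W^`(j k)%classic (tnth x k / c k)).

Lemma tensor_row2tup W c j :
  tensor W c j \o @row2tup R N =
  fun v => \prod_(k < N) (c k ^- j k * W^`(j k)%classic (v ord0 k / c k)).
Proof.
by apply/funext => v /=; apply: eq_bigr => k _; rewrite tnth_mktuple.
Qed.

Lemma is_derive_rescaled (W : R -> R) (a : R) n (t : R) : smooth1 W ->
  is_derive t 1 (fun s => a ^- n * W^`(n)%classic (s / a))
    (a ^- n.+1 * W^`(n.+1)%classic (t / a)).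
Proof.
move=> sW.
have dW := smooth1_derivable _ (t / a) (smooth1_derive1n n _ sW).
have di : is_derive t 1 (fun s : R => s / a) (a^-1 *: 1).
  rewrite (_ : (fun s => s / a) = a^-1 *: id); last first.
    by apply/funext => s; rewrite fctE /GRing.scale/= mulrC.
  exact: is_deriveZ.
have h := @is_derive1_comp _ _ (fun s => s / a) _ _ _ (derivableP dW) di.
have : is_derive t 1 (fun s => a ^- n * W^`(n)%classic (s / a))
    (a ^- n *: ('D_1 W^`(n)%classic (t / a) * a^-1%:A)) by exact: is_deriveZ h.
rewrite -derive1E -derive1nS /GRing.scale/= mulr1 => dh.
by apply: (is_derive_eq dh); rewrite exprSr invfM; ring.
Qed.

Lemma is_derive_tensor W c j v i : smooth1 W ->
  is_derive v (delta_mx ord0 i) (tensor W c j \o @row2tup R N)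
    (tensor W c (fun k => (k == i) + j k)%N (row2tup v)).
Proof.
move=> sW; rewrite tensor_row2tup.
have [dw dwE] := is_derive_rescaled W (c i) (j i) (v ord0 i) sW.
have := is_derive_prod_coord
  (fun k s => c k ^- j k * W^`(j k)%classic (s / c k)) v i dw.
move=> /is_derive_eq; apply.
rewrite derive1E dwE /tensor [RHS](bigD1 i)//= tnth_mktuple eqxx add1n.
congr (_ * _); apply: eq_bigr => k /negbTE ki.
by rewrite tnth_mktuple ki add0n.
Qed.

Lemma tup2rowK : cancel (@tup2row R N) (@row2tup R N).
Proof. by move=> x; apply/eq_from_tnth => i; rewrite tnth_mktuple mxE. Qed.

Lemma pd_tensor W c j i : smooth1 W ->
  pd i (tensor W c j) = tensor W c (fun k => (k == i) + j k)%N.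
Proof.
move=> sW; apply/funext => x; rewrite /pd.
by have [_ ->] := is_derive_tensor W c j (tup2row x) i sW; rewrite tup2rowK.
Qed.

Lemma eq_tensor W c j j' : j =1 j' -> tensor W c j = tensor W c j'.
Proof.
by move=> jj; apply/funext => x; apply: eq_bigr => k _; rewrite jj.
Qed.

Lemma iter_pd_tensor W c j i n : smooth1 W ->
  iter n (pd i) (tensor W c j) = tensor W c (fun k => n * (k == i) + j k)%N.
Proof.
move=> sW; elim: n => [|n ih]; first exact: eq_tensor.
by rewrite iterS ih pd_tensor//; apply: eq_tensor => k; rewrite mulSn addnA.
Qed.

Lemma foldr_pd_tensor W c j (s : seq 'I_N) : smooth1 W ->
  foldr (@pd R N) (tensor W c j) s =
  tensor W c (fun k => count_mem k s + j k)%N.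
Proof.
move=> sW; elim: s => [|i s ih] /=; first exact: eq_tensor.
by rewrite ih pd_tensor//; apply: eq_tensor => k; rewrite addnA eq_sym.
Qed.

Lemma dalpha_tensor W c m (al : multi_index N m) : smooth1 W ->
  dalpha al (tensor W c (fun=> 0%N)) = tensor W c (fun k => al k : nat).
Proof.
move=> sW; rewrite /dalpha.
(* The induction runs over arbitrary lists of indices; in [enum 'I_N] each index occurs once. *)
have -> : forall s : seq 'I_N,
    foldr (fun i psi => iter (al i) (pd i) psi) (tensor W c (fun=> 0%N)) s =
    tensor W c (fun k => al k * count_mem k s)%N.
  elim=> [|i s ih] /=; first by apply: eq_tensor => k; rewrite muln0.
  rewrite ih iter_pd_tensor//; apply: eq_tensor => k.
  rewrite mulnDr [i == k]eq_sym; case: (eqVneq k i) => [->//|_].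
  by rewrite !muln0.
apply: eq_tensor => k; rewrite count_uniq_mem; last exact: enum_uniq.
by rewrite mem_enum muln1.
Qed.

Lemma continuous_tensor W c j : smooth1 W ->
  continuous (tensor W c j \o @row2tup R N).
Proof.
move=> sW; rewrite tensor_row2tup.
elim: (index_enum 'I_N) => [|i s ih].
  by under eq_fun do rewrite big_nil; exact: cst_continuous.
under eq_fun do rewrite big_cons.
have ci : continuous (fun v : 'rV[R]_N =>
    c i ^- j i * W^`(j i)%classic (v ord0 i / c i)).
  have cW : continuous (W^`(j i)%classic).
    by apply: smooth1_continuous; exact: smooth1_derive1n.
  have cv : continuous (fun v : 'rV[R]_N => v ord0 i / c i).
    by move=> v; exact: (cvgM (@coord_continuous R 1 N ord0 i v) (cvg_cst _)).
  by move=> v; exact: (cvgM (cvg_cst _) (continuous_comp (cv v) (cW _))).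
by move=> v; exact: cvgM (ci v) (ih v).
Qed.

Lemma smooth_tensor W c j : smooth1 W -> smooth (tensor W c j).
Proof.
move=> sW s; rewrite foldr_pd_tensor//; split; first exact: continuous_tensor.
by move=> i v; have [] := is_derive_tensor W c
  (fun k => count_mem k s + j k)%N v i sW.
Qed.

Lemma measurable_tensor W c j : smooth1 W ->
  measurable_fun [set: N.-tuple R] (tensor W c j).
Proof.
move=> sW; apply: measurable_prod => k _; apply: measurable_funM => //.
apply: (measurableT_comp (f := W^`(j k)%classic)).
  apply: continuous_measurable_fun.
  by apply: smooth1_continuous; exact: smooth1_derive1n.
by apply: measurable_funM => //; exact: measurable_tnth.
Qed.

Lemma test_fun_tensor W c : smooth1 W -> (forall k, 0 < c k) ->
  (forall t, 1 < `|t| -> W t = 0) -> test_fun (tensor W c (fun=> 0%N)).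
Proof.
move=> sW c0 W0; split; first exact: smooth_tensor.
(* The sum of the positive radii dominates each one, so a coordinate beyond it satisfies |x_i| / c_i
   > 1. *)
exists (\sum_k c k) => x [i xi]; rewrite /tensor (bigD1 i)//=.
rewrite W0 ?mulr0 ?mul0r// normrM normfV (gtr0_norm (c0 i)) ltr_pdivlMr//.
rewrite mul1r (le_lt_trans _ xi)// (bigD1 i)//= lerDl sumr_ge0// => k _.
exact: ltW.
Qed.

End TensorCutoff.

(** * Weighted Hoelder inequality and absorption *)

Section WeightedHoelder.
Context {d : measure_display} {T : measurableType d} {R : realType}.
Variable mu : {measure set T -> \bar R}.

(** Hoelder's inequality for the factors |u| (th phi)^(1/p) 1_Q and |a| th^(-1/p) 1_Q; the exponent
    of the weight is -q/p = -(q - 1). The absolute value of [th] makes the integrand nonnegative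
    everywhere, while th > 0 holds only almost everywhere. *)
Lemma hoelder_weighted (p q : R) (u a th phi : T -> R) (Q : set T) :
  0 < p -> 0 < q -> p^-1 + q^-1 = 1 ->
  measurable_fun setT u -> measurable_fun setT a -> measurable_fun setT th ->
  measurable_fun setT phi -> measurable Q -> (forall x, 0 <= phi x) ->
  {ae mu, forall x, 0 < th x} ->
  (\int[mu]_x (`|u x| * `|a x| * (phi x `^ p^-1 * \1_Q x))%:E <=
   (\int[mu]_(x in Q) (`|th x| * `|u x| `^ p * phi x)%:E) `^ p^-1 *
   (\int[mu]_(x in Q) (`|a x| `^ q * th x `^ (- (q - 1)))%:E) `^ q^-1)%E.
Proof.
move=> p0 q0 pq mu_ ma mth mphi mQ phi0 th0.
have mpow (g : T -> R) r : measurable_fun setT g ->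
    measurable_fun setT (fun x => g x `^ r).
  by move=> mg; exact: (measurableT_comp (measurable_powR r)).
have mnorm (g : T -> R) : measurable_fun setT g ->
    measurable_fun setT (fun x => `|g x|).
  by move=> mg; exact: (measurableT_comp (@normr_measurable _ setT)).
have m1 : measurable_fun setT (\1_Q : T -> R) by exact/measurable_indicP.
pose f1 x := `|u x| * (`|th x| `^ p^-1 * (phi x `^ p^-1 * \1_Q x)).
pose f2 x := `|a x| * (th x `^ (- p^-1) * \1_Q x).
have mf1 : measurable_fun setT f1.
  apply: measurable_funM; first exact: mnorm.
  apply: measurable_funM; first by apply: mpow; exact: mnorm.
  by apply: measurable_funM; first exact: mpow.
have mf2 : measurable_fun setT f2.
  apply: measurable_funM; first exact: mnorm.
  by apply: measurable_funM; first exact: mpow.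
have pn0 : p != 0 by rewrite gt_eqF.
have qn0 : q != 0 by rewrite gt_eqF.
have qp : q * p^-1 = q - 1.
  by rewrite -[p^-1](addrK q^-1) pq mulrBr mulr1 mulfV.
have h := hoelder mu mf1 mf2 p0 q0 pq.
(* The two weights cancel where th > 0, hence an almost everywhere equality. *)
have -> : (\int[mu]_x (`|u x| * `|a x| * (phi x `^ p^-1 * \1_Q x))%:E =
    Lnorm mu 1 (EFin \o (f1 \* f2)%R))%E.
  rewrite Lnorm1; apply: ge0_ae_eq_integral => //.
  - apply/measurable_EFinP; apply: measurable_funM.
      by apply: measurable_funM; exact: mnorm.
    by apply: measurable_funM => //; exact: mpow.
  - apply: (measurableT_comp (f := abse)) => //.
    by apply/measurable_EFinP; exact: measurable_funM.
  - by move=> x _; rewrite lee_fin !mulr_ge0 ?powR_ge0.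
  apply: filterS th0 => x th0 _ /=; congr EFin.
  rewrite [RHS]ger0_norm; last by rewrite /f1 /f2 !mulr_ge0 ?powR_ge0.
  rewrite /f1 /f2 (gtr0_norm th0) powRN.
  have t0 : th x `^ p^-1 != 0 by rewrite gt_eqF// powR_gt0.
  have i2 : \1_Q x * \1_Q x = \1_Q x :> R.
    by rewrite indicE; case: (_ \in _); rewrite ?mulr1 ?mulr0.
  transitivity (`|u x| * `|a x| * (phi x `^ p^-1 * (\1_Q x * \1_Q x))).
    by rewrite i2.
  by field.
have -> : ((\int[mu]_(x in Q) (`|th x| * `|u x| `^ p * phi x)%:E) `^ p^-1 =
    Lnorm mu p%:E (EFin \o f1))%E.
  rewrite unlock; congr (_ `^ _)%E.
  rewrite integral_mkcond epatch_indic; apply: eq_integral => x _ /=.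
  rewrite -EFinM; congr EFin.
  rewrite [`|f1 x|]ger0_norm; last by rewrite /f1 !mulr_ge0 ?powR_ge0.
  rewrite /f1 !powRM ?mulr_ge0 ?powR_ge0//.
  rewrite -!powRrM mulVf// !powRr1// indicE.
  by case: (_ \in _); rewrite ?powR1 ?powR0//=; ring.
have -> : ((\int[mu]_(x in Q) (`|a x| `^ q * th x `^ (- (q - 1)))%:E) `^ q^-1 =
    Lnorm mu q%:E (EFin \o f2))%E.
  rewrite unlock; congr (_ `^ _)%E.
  rewrite integral_mkcond epatch_indic; apply: eq_integral => x _ /=.
  rewrite -EFinM; congr EFin.
  rewrite [`|f2 x|]ger0_norm; last by rewrite /f2 !mulr_ge0 ?powR_ge0.
  rewrite /f2 !powRM ?mulr_ge0 ?powR_ge0//.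
  rewrite -!powRrM mulNr mulrC [p^-1 * q]mulrC qp indicE.
  by case: (_ \in _); rewrite ?powR1 ?powR0//=; ring.
exact: h.
Qed.

(* The inequality with [B = setT] bounds [\int w] and the one with
   [B = ~` D n] then makes it vanish. *)
Lemma integral_eq0_of_selfimproving (p K : R) (w : T -> R) (D : nat -> set T) :
  1 < p -> 0 <= K -> measurable_fun setT w -> (forall x, 0 <= w x) ->
  (forall n, measurable (D n)) -> nondecreasing_seq D -> \bigcup_n D n = setT ->
  (forall n, exists phi : T -> R, [/\ measurable_fun setT phi,
     forall x, 0 <= phi x <= 1, forall x, D n x -> phi x = 1,
     (\int[mu]_x (w x * phi x)%:E < +oo)%E &
     forall B, B = setT \/ B = ~` D n ->
       (\int[mu]_x (w x * phi x)%:E <=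
        K%:E * (\int[mu]_(x in B) (w x * phi x)%:E) `^ p^-1)%E]) ->
  (\int[mu]_x (w x)%:E)%E = 0%E.
Proof.
move=> p1 K0 mw w0 mD ndD DT H.
have p0 : 0 < p by rewrite (lt_trans _ p1).
have pn0 : p != 0 by rewrite gt_eqF.
have mwE (A : set T) : measurable_fun A (EFin \o w).
  by apply: measurable_funTS; exact/measurable_EFinP.
have wE0 x : (0 <= (w x)%:E)%E by rewrite lee_fin.
have I0 (A : set T) : (0 <= \int[mu]_(x in A) (w x)%:E)%E.
  exact: integral_ge0.
have Dphi n (phi : T -> R) : measurable_fun setT phi ->
    (forall x, 0 <= phi x <= 1) ->
    (forall x, D n x -> phi x = 1) ->
    (\int[mu]_(x in D n) (w x)%:E <= \int[mu]_x (w x * phi x)%:E)%E.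
  move=> mphi phi01 phi1.
  rewrite (_ : (\int[mu]_(x in D n) (w x)%:E =
      \int[mu]_(x in D n) (w x * phi x)%:E)%E).
    apply: ge0_subset_integral => //.
      by apply/measurable_EFinP; exact: measurable_funM.
    by move=> x _; rewrite lee_fin mulr_ge0//; case/andP: (phi01 x).
  by apply: eq_integral => x /set_mem Dx; rewrite phi1// mulr1.
(* A finite r >= 0 with r <= K r^(1/p) satisfies r <= K^(1 / (1 - 1/p)). *)
pose M := K `^ (1 - p^-1)^-1.
have ip : 0 < 1 - p^-1 by rewrite subr_gt0 invf_lt1.
have bM n : (\int[mu]_(x in D n) (w x)%:E <= M%:E)%E.
  have [phi [mphi phi01 phi1 fin est]] := H n.
  apply: le_trans (Dphi n phi mphi phi01 phi1) _.
  have := est setT (or_introl erefl).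
  have : (0 <= \int[mu]_x (w x * phi x)%:E)%E.
    apply: integral_ge0 => x _; rewrite lee_fin mulr_ge0//.
    by case/andP: (phi01 x).
  move: fin; case: (integral _ _ _) => // r _; rewrite lee_fin => r0.
  rewrite poweR_EFin -EFinM !lee_fin => rK.
  have [->|rn0] := eqVneq r 0; first exact: powR_ge0.
  have rp : 0 < r by rewrite lt0r rn0.
  have rK' : r `^ (1 - p^-1) <= K.
    rewrite powRB; last by rewrite rn0 implybT.
    by rewrite powRr1// ler_pdivrMr ?powR_gt0.
  have -> : r = (r `^ (1 - p^-1)) `^ (1 - p^-1)^-1.
    by rewrite -powRrM mulfV ?powRr1// gt_eqF.
  by rewrite ge0_ler_powR ?nnegrE ?powR_ge0// invr_ge0 ltW.
have cvgI : (\int[mu]_(x in D n) (w x)%:E)%E @[n --> \oo] -->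
    (\int[mu]_x (w x)%:E)%E.
  by rewrite -DT; apply: ge0_nondecreasing_set_cvg_integral => //.
have IM : (\int[mu]_x (w x)%:E <= M%:E)%E.
  rewrite -(cvg_lim _ cvgI)//; apply: lime_le.
    by apply/cvg_ex; eexists; exact: cvgI.
  by apply: nearW => n; exact: bM.
have Ifin : (\int[mu]_x (w x)%:E)%E \is a fin_num.
  by rewrite ge0_fin_numE// (le_lt_trans IM)// ltry.
pose s := fine (\int[mu]_x (w x)%:E)%E.
pose sn n := fine (\int[mu]_(x in D n) (w x)%:E)%E.
have Es : (\int[mu]_x (w x)%:E = s%:E)%E by rewrite fineK.
have Esn n : (\int[mu]_(x in D n) (w x)%:E = (sn n)%:E)%E.
  by rewrite fineK// ge0_fin_numE// (le_lt_trans (bM n))// ltry.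
have s0 : 0 <= s by rewrite fine_ge0.
have sn0 n : 0 <= sn n by rewrite fine_ge0.
have cvgs : sn n @[n --> \oo] --> s.
  by move: cvgI; rewrite Es => /fine_cvgP[].
(* Outside [D n] the integral of w is s - sn n, so the second choice of B bounds sn n by a tail. *)
have tail n : sn n <= K * (s - sn n) `^ p^-1.
  have [phi [mphi phi01 phi1 _ est]] := H n.
  rewrite -lee_fin -Esn; apply: le_trans (Dphi n phi mphi phi01 phi1) _.
  apply: le_trans (est _ (or_intror erefl)) _.
  rewrite EFinM lee_wpmul2l ?lee_fin//.
  rewrite -poweR_EFin; apply: gt0_ler_poweR => //.
  - by rewrite invr_ge0 ltW.
  - rewrite in_itv/= leey andbT integral_ge0// => x _.
    by rewrite lee_fin mulr_ge0//; case/andP: (phi01 x).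
  - rewrite in_itv/= leey andbT lee_fin subr_ge0 -lee_fin -Es -Esn.
    exact: ge0_subset_integral.
  rewrite EFinB -Es -Esn -(setUv (D n)) ge0_integral_setU//; last 2 first.
  - exact: measurableC.
  - exact/disj_setPCl.
  rewrite [in leRHS]Esn addeAC subee// add0e.
  apply: ge0_le_integral => //.
  - exact: measurableC.
  - by move=> x _; rewrite lee_fin mulr_ge0//; case/andP: (phi01 x).
  - apply: measurable_funTS; apply/measurable_EFinP; exact: measurable_funM.
  - by move=> x _; rewrite lee_fin ler_piMr//; case/andP: (phi01 x).
have [s00|] := eqVneq s 0; first by rewrite Es s00.
move=> sneq0; have sp : 0 < s by rewrite lt0r sneq0.
exfalso.
(* When s - sn n < e, the tail bound gives sn n <= K (s/2) / (K + 1) <= s/2, against sn n > s/2. The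
   divisor K + 1 also covers K = 0. *)
pose e := (s / 2 / (K + 1)) `^ p.
have K1 : 0 < K + 1 by rewrite ltr_wpDl.
have e0 : 0 < e by rewrite powR_gt0// !divr_gt0.
have s20 : 0 < s / 2 by rewrite divr_gt0.
have [n _ /(_ n (leqnn n)) [n1 n2]] :
    \forall n \near \oo, s / 2 < sn n /\ s - sn n < e.
  near=> n; split; near: n.
    by apply: (cvgr_gt s) => //; rewrite ltr_pdivrMr// ltr_pMr// ltr1n.
  have : s - e < s by rewrite gtrBl.
  move=> /(cvgr_gt s cvgs); apply: filterS => n; lra.
have t0 : 0 <= s - sn n.
  rewrite subr_ge0 -lee_fin -Es -Esn; exact: ge0_subset_integral.
have := tail n.
have : (s - sn n) `^ p^-1 <= s / 2 / (K + 1).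
  have -> : s / 2 / (K + 1) = e `^ p^-1.
    by rewrite -powRrM mulfV// powRr1// divr_ge0// ltW.
  by rewrite ge0_ler_powR ?nnegrE ?powR_ge0// ?invr_ge0 ltW.
set t := (_ `^ _); move=> tle snle.
have : K * t <= K * (s / 2 / (K + 1)) by rewrite ler_wpM2l.
have : K * (s / 2 / (K + 1)) <= s / 2.
  by rewrite mulrCA ler_piMr ?(ltW s20)// ler_pdivrMr// mul1r lerDl.
lra.
Unshelve. all: by end_near.
Qed.

End WeightedHoelder.

(** * The test-function estimate *)

Section TensorEstimate.
Context {R : realType} {N : nat}.

Lemma measurable_coordinatewise (P : 'I_N -> set R) :
  (forall i, measurable (P i)) ->
  measurable [set x : N.-tuple R | forall i, P i (tnth x i)].
Proof.
move=> mP.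
rewrite (_ : [set _ | _] =
    \bigcap_(i in [set: 'I_N])
      ((fun x : N.-tuple R => tnth x i) @^-1` P i)); last first.
  by apply/seteqP; split => [x Px i _|x Px i]; [exact: Px|exact: Px i I].
apply: fin_bigcap_measurable => // i _.
by rewrite -[X in measurable X]setTI; apply: measurable_tnth.
Qed.

Lemma measurable_cube (r : R) : measurable (@cube R N r).
Proof.
apply: (measurable_coordinatewise (fun=> [set t | `|t| <= r])) => _.
rewrite -[X in measurable X]setTI -preimage_itvNyc.
exact: (@normr_measurable R setT measurableT _ (measurable_itv _)).
Qed.

(** This is Q_R^(alpha) with c_i for F_i(R) and j for alpha; it carries the derivative of order [j]
    of the tensor cutoff. *)
Definition shell (c : 'I_N -> R) (j : 'I_N -> nat) : set (N.-tuple R) :=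
  [set x | forall i, `|tnth x i| <= c i /\
    (j i != 0%N -> c i / 2 <= `|tnth x i|)].

Lemma measurable_shell c j : measurable (shell c j).
Proof.
apply: (measurable_coordinatewise (fun i => [set t | `|t| <= c i /\
  (j i != 0%N -> c i / 2 <= `|t|)])) => i.
have mN (I : interval R) : measurable ((Num.norm : R -> R) @^-1` [set` I]).
  rewrite -[X in measurable X]setTI.
  exact: (@normr_measurable R setT measurableT _ (measurable_itv _)).
case: eqVneq => [ji|ji].
  rewrite (_ : [set _ | _] = (Num.norm : R -> R) @^-1` `]-oo, c i]%classic)//.
  by apply/seteqP; split => t /=; rewrite in_itv/= => // -[].
rewrite (_ : [set _ | _] = (Num.norm : R -> R) @^-1` `[c i / 2, c i]%classic)//.
apply/seteqP; split => t /=; rewrite in_itv/=; first by case=> -> /(_ erefl) ->.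
by case/andP.
Qed.

Lemma powR_prod (I : Type) (s : seq I) (h : I -> R) (r : R) :
  (forall i, 0 <= h i) ->
  \prod_(i <- s) (h i `^ r) = (\prod_(i <- s) h i) `^ r.
Proof.
move=> h0; elim: s => [|i s ih]; first by rewrite !big_nil powR1.
by rewrite !big_cons ih powRM// prodr_ge0.
Qed.

Lemma tensor01 (W : R -> R) (c : 'I_N -> R) x : (forall t, 0 <= W t <= 1) ->
  0 <= tensor W c (fun=> 0%N) x <= 1.
Proof.
move=> W01; apply/andP; split.
  apply: prodr_ge0 => k _; rewrite expr0 invr1 mul1r.
  by case/andP: (W01 (tnth x k / c k)).
by apply: prodr_ile1 => k _; rewrite expr0 invr1 mul1r.
Qed.

Lemma tensor_eq1 (W : R -> R) (c : 'I_N -> R) (r : R) x :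
  (forall t, `|t| <= 2^-1 -> W t = 1) -> (forall k, 0 < c k) ->
  (forall k, r <= c k / 2) -> cube r x -> tensor W c (fun=> 0%N) x = 1.
Proof.
move=> W1 c0 rc xr; apply: big1 => k _.
rewrite expr0 invr1 mul1r derive1n0 W1//.
rewrite normrM normfV (gtr0_norm (c0 k)) ler_pdivrMr// mulrC.
exact: le_trans (xr k) (rc k).
Qed.

(** Multiply the one-variable bounds over the coordinates: the factors W^(1/p) combine into
    phi^(1/p) for the undifferentiated cutoff phi, and the constraints on each |x_k| into the
    indicator of the shell. *)
Lemma tensor_bound (W : R -> R) (C p : R) (c : 'I_N -> R) (j : 'I_N -> nat) x :
  (forall t, 0 <= W t) -> (forall k, 0 < c k) -> 0 <= C ->
  (forall n t, 1 < `|t| -> W^`(n)%classic t = 0) ->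
  (forall k t, `|W^`(j k)%classic t| <=
    C * (W t `^ p^-1) * ((j k != 0%N) ==> (2^-1 <= `|t|))%:R) ->
  `|tensor W c j x| <= C ^+ N * (\prod_(k < N) c k ^- j k) *
    (tensor W c (fun=> 0%N) x `^ p^-1 * \1_(shell c j) x).
Proof.
move=> W0 c0 C0 supp bnd.
pose t k := tnth x k / c k.
(* The bound on the derivatives only records |t_k| >= 1/2; the condition |t_k| <= 1 of the shell
   comes from [supp]. *)
pose b k := (`|t k| <= 1) && ((j k != 0%N) ==> (2^-1 <= `|t k|)).
have tE k : `|t k| = `|tnth x k| / c k.
  by rewrite /t normrM normfV (gtr0_norm (c0 k)).
have -> : \1_(shell c j) x = \prod_(k < N) ((b k)%:R : R).
  rewrite indicE; case: (boolP (x \in _)) => [/set_mem xs|/negP xs].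
    rewrite big1// => k _; rewrite /b tE ler_pdivrMr// mul1r (xs k).1/=.
    case: implyP => //; case=> /(xs k).2.
    by rewrite ler_pdivlMr// mulrC.
  have [k kb] : exists k, ~~ b k.
    apply/existsP; rewrite -negb_forall; apply/negP => /forallP ball.
    apply: xs; apply/mem_set => k; have := ball k.
    rewrite /b tE ler_pdivrMr// mul1r => /andP[-> /implyP h]; split => // /h.
    by rewrite ler_pdivlMr// mulrC.
  by rewrite (bigD1 k)//= (negbTE kb) mul0r.
have -> : tensor W c (fun=> 0%N) x `^ p^-1 = \prod_(k < N) (W (t k) `^ p^-1).
  rewrite powR_prod//; congr (_ `^ _).
  by apply: eq_bigr => k _; rewrite expr0 invr1 mul1r.
rewrite -[X in C ^+ X]card_ord -prodr_const -!big_split/= /tensor normr_prod.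
apply: ler_prod => k _; rewrite normr_ge0/= normrM -/(t k).
have ck : 0 <= c k ^- j k by rewrite invr_ge0 exprn_ge0// ltW.
rewrite (ger0_norm ck) [C * _]mulrC -mulrA ler_wpM2l//.
have [t1|t1] := lerP `|t k| 1; last first.
  by rewrite supp// normr0 !mulr_ge0 ?powR_ge0.
by rewrite mulrA /b t1.
Qed.

(** Hoelder's inequality is applied on the shell of each multi-index. Then only the integral of |th|
    |u|^p phi is enlarged from the shell to B, so that the same power of one integral factors out of
    the sum. *)
Lemma le_integral_diff_op_tensor m (mu : {measure set (N.-tuple R) -> \bar R})
    (p q C : R) (W : R -> R) (c : 'I_N -> R)
    (a : multi_index N m -> N.-tuple R -> R) (u th : N.-tuple R -> R)
    (K : multi_index N m -> R) (B : set (N.-tuple R)) :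
  0 < p -> 0 < q -> p^-1 + q^-1 = 1 -> 0 <= C ->
  smooth1 W -> (forall t, 0 <= W t <= 1) -> (forall k, 0 < c k) ->
  (forall n t, 1 < `|t| -> W^`(n)%classic t = 0) ->
  (forall n t, (n <= m)%N -> `|W^`(n)%classic t| <=
    C * (W t `^ p^-1) * ((n != 0%N) ==> (2^-1 <= `|t|))%:R) ->
  measurable_fun setT u -> measurable_fun setT th ->
  (forall al, measurable_fun setT (a al)) ->
  {ae mu, forall x, 0 < th x} -> measurable B ->
  (forall al : multi_index N m, (1 <= mi_size al <= m)%N ->
    shell c (fun i => al i) `<=` B /\
    ((\prod_(i < N) c i ^- (al i : nat))%:E *
      (\int[mu]_(x in shell c (fun i => al i))
         (`|a al x| `^ q * th x `^ (- (q - 1)))%:E) `^ q^-1 <= (K al)%:E)%E) ->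
  (\int[mu]_x `|(u x * diff_op 1 a (tensor W c (fun=> 0%N)) x)%:E| <=
   (\sum_(al : multi_index N m | (1 <= mi_size al <= m)%N) C ^+ N * K al)%:E *
   (\int[mu]_(x in B)
     (`|th x| * `|u x| `^ p * tensor W c (fun=> 0%N) x)%:E) `^ p^-1)%E.
Proof.
move=> p0 q0 pq C0 sW W01 c0 supp bnd mu_ mth ma th0 mB HK.
set phi := tensor W c (fun=> 0%N).
have phi01 x : 0 <= phi x <= 1 by exact: tensor01.
have phi0 x : 0 <= phi x by case/andP: (phi01 x).
have mphi : measurable_fun setT phi by exact: measurable_tensor.
have mnorm (g : N.-tuple R -> R) : measurable_fun setT g ->
    measurable_fun setT (fun x => `|g x|).
  by move=> mg; exact: (measurableT_comp (@normr_measurable _ setT)).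
have mpow (g : N.-tuple R -> R) r : measurable_fun setT g ->
    measurable_fun setT (fun x => g x `^ r).
  by move=> mg; exact: (measurableT_comp (measurable_powR r)).
pose H (al : multi_index N m) := \prod_(i < N) c i ^- (al i : nat).
have H0 al : 0 <= H al.
  by apply: prodr_ge0 => i _; rewrite invr_ge0 exprn_ge0// ltW.
pose S (al : multi_index N m) : set (N.-tuple R) := shell c (fun i => al i).
pose h al x := `|u x| * `|a al x| * (phi x `^ p^-1 * \1_(S al) x).
have h0 al x : 0 <= h al x by rewrite /h !mulr_ge0 ?powR_ge0.
have mh al : measurable_fun setT (h al).
  apply: measurable_funM; first by apply: measurable_funM; exact: mnorm.
  apply: measurable_funM; first exact: mpow.
  by apply/measurable_indicP; exact: measurable_shell.
have CN0 : 0 <= C ^+ N by rewrite exprn_ge0.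
have le1 : (\int[mu]_x `|(u x * diff_op 1 a phi x)%:E| <=
    \int[mu]_x \sum_(al <- [seq al <- index_enum (multi_index N m) |
       (1 <= mi_size al <= m)%N]) ((C ^+ N * H al)%:E * (h al x)%:E))%E.
  apply: ge0_le_integral => //.
  - apply: (measurableT_comp (f := abse)) => //.
    apply/measurable_EFinP; apply: measurable_funM => //.
    rewrite /diff_op; under eq_fun do rewrite -big_filter.
    apply: measurable_sum => al; apply: measurable_funM => //.
    by rewrite dalpha_tensor//; exact: measurable_tensor.
  - apply: emeasurable_sum => al; apply/measurable_EFinP.
    by apply: measurable_funM.
  move=> x _ /=; under eq_bigr do rewrite -EFinM.
  rewrite sumEFin lee_fin big_filter normrM.
  rewrite /diff_op (le_trans (ler_wpM2l (normr_ge0 _) (ler_norm_sum _ _ _)))//.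
  rewrite mulr_sumr; apply: ler_sum => al /andP[_ alm].
  rewrite normrM dalpha_tensor// [leLHS]mulrA /h [leRHS]mulrCA.
  rewrite ler_wpM2l ?mulr_ge0//.
  rewrite -/(H al); apply: tensor_bound => //.
  - by move=> t; case/andP: (W01 t).
  - move=> k t; apply: bnd; exact: leq_ord.
apply: (le_trans le1); rewrite ge0_integral_sum//; last 2 first.
- by move=> al; apply/measurable_EFinP; exact: measurable_funM.
- by move=> al x _; rewrite -EFinM lee_fin mulr_ge0// mulr_ge0.
rewrite big_filter -sumEFin ge0_sume_distrl; last first.
  (* [K al] bounds a nonnegative quantity, hence is itself nonnegative, as distributing over the sum
     in the extended reals requires. *)
  move=> al /HK [_ KH]; rewrite EFinM mule_ge0 ?lee_fin//.
  by rewrite -lee_fin (le_trans _ KH)// mule_ge0 ?poweR_ge0// lee_fin H0.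
apply: lee_sum => al /[dup] alm /HK[SB KH].
rewrite ge0_integralZl_EFin//; last 3 first.
- by move=> x _; rewrite lee_fin.
- exact/measurable_EFinP.
- by rewrite mulr_ge0.
have hold := hoelder_weighted mu p q u (a al) th phi _
  p0 q0 pq mu_ (ma al) mth mphi
  (measurable_shell c (fun i => al i)) phi0 th0.
apply: le_trans (lee_wpmul2l _ hold) _; first by rewrite lee_fin mulr_ge0.
rewrite EFinM -muleA EFinM -muleA lee_wpmul2l ?lee_fin//.
(* H_alpha joins the factor containing [a al] to form the quantity bounded by [K al]. *)
rewrite muleCA muleC lee_pmul ?mule_ge0 ?poweR_ge0 ?lee_fin//.
apply: gt0_ler_poweR.
- by rewrite invr_ge0 ltW.
- rewrite in_itv/= leey andbT integral_ge0// => x _.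
  by rewrite lee_fin !mulr_ge0 ?powR_ge0.
- rewrite in_itv/= leey andbT integral_ge0// => x _.
  by rewrite lee_fin !mulr_ge0 ?powR_ge0.
apply: ge0_subset_integral => //; first exact: measurable_shell.
  apply: measurable_funTS; apply/measurable_EFinP.
  apply: measurable_funM => //; apply: measurable_funM; first exact: mnorm.
  by apply: mpow; exact: mnorm.
by move=> x _; rewrite lee_fin !mulr_ge0 ?powR_ge0.
Qed.

End TensorEstimate.

(** * Choice of the radii, absorption, and vanishing of the solution *)

Theorem theorem2p15 (R : realType) (N m : nat) (p : R)
    (mu : {measure set (N.-tuple R) -> \bar R})
    (b : multi_index N m -> N.-tuple R -> R)
    (a : multi_index N m -> N.-tuple R -> R)
    (f g u : N.-tuple R -> R) (F : 'I_N -> R -> R) :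
  is_lebesgue_measureN mu ->
  (1 <= N)%N -> 1 < p ->
  (* L = sum_{|alpha| <= m} b_alpha partial^alpha, a linear differential operator of order m *)
  (forall al, measurable_fun setT (b al)) ->
  Linfloc mu f -> {ae mu, forall x, 0 < f x} ->
  measurable_fun setT g -> {ae mu, forall x, 0 < g x} ->
  (* D^* = sum_{1 <= |alpha| <= m} a_alpha partial^alpha is the formal adjoint of D = gL *)
  (forall al, Linfloc mu (a al)) ->
  (forall v w, test_fun v -> test_fun w ->
     mu.-integrable setT (fun x => (v x * (g x * diff_op 0 b w x))%:E) /\
     (\int[mu]_x (v x * (g x * diff_op 0 b w x))%:E =
      \int[mu]_x (w x * diff_op 1 a v x)%:E)%E) ->
  (* u is a global g-solution of L u = f |u|^p *)
  L1loc mu u ->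
  L1loc mu (fun x => f x * g x * `|u x| `^ p) ->
  (forall phi, test_fun phi ->
     (\int[mu]_x (f x * g x * `|u x| `^ p * phi x)%:E =
      \int[mu]_x (u x * diff_op 1 a phi x)%:E)%E) ->
  (* the functions F_i *)
  (forall i, forall x y, 0 < x -> x < y -> F i x < F i y) ->
  (forall i, forall x, 0 < x -> 0 < F i x) ->
  (forall i, {within `]0, +oo[, continuous (F i)}) ->
  (forall i, F i x @[x --> +oo] --> +oo) ->
  (* limsup_{R -> oo} H_alpha(R) G_alpha(R)^{1/p'} < oo for 1 <= |alpha| <= m *)
  (let p' := p / (p - 1) in
   forall al : multi_index N m, (1 <= mi_size al <= m)%N ->
   exists C : R, \forall r \near +oo,
     (((\prod_(i < N) (F i r) ^- (al i : nat))%:E) *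
      (\int[mu]_(x in [set x : N.-tuple R | (forall i, `|tnth x i| <= F i r /\
                                 ((al i : nat) != 0%N -> F i r / 2 <= `|tnth x i|))%R])
         ((`|a al x| `^ p') * (g x * f x) `^ (- (p' - 1)))%R%:E) `^ (p'^-1) <= C%:E)%E) ->
  {ae mu, forall x, u x = 0}.
Proof.
move=> _ _ p1 _ [mf _] f0 mg g0 Ha _ [mu_ _] [mw_ iw] sol _ F0 _ Fy /= HG.
have p0 : 0 < p by rewrite (lt_trans _ p1).
pose q := p / (p - 1).
have p10 : 0 < p - 1 by rewrite subr_gt0.
have q0 : 0 < q by rewrite divr_gt0.
have pq : p^-1 + q^-1 = 1.
  by rewrite /q; field; rewrite !gt_eqF.
pose th x := g x * f x.
have mth : measurable_fun setT th by exact: measurable_funM.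
have ma al : measurable_fun setT (a al) by case: (Ha al).
have th0 : {ae mu, forall x, 0 < th x}.
  by apply: filterS2 f0 g0 => x fx gx; rewrite mulr_gt0.
(* The absolute value makes w nonnegative everywhere; almost everywhere w = f g |u|^p. *)
pose w x := `|th x| * `|u x| `^ p.
have mw : measurable_fun setT w.
  apply: measurable_funM.
    exact: (measurableT_comp (@normr_measurable _ setT)).
  apply: (measurableT_comp (measurable_powR p)).
  exact: (measurableT_comp (@normr_measurable _ setT)).
have w0 x : 0 <= w x by rewrite mulr_ge0 ?powR_ge0.
have [W [sW W01 W1 supp [C C1 bnd]]] := exists_weighted_cutoff m p p1.
have C0 : 0 <= C by rewrite (le_trans _ C1).
(* The constants are fixed before r is chosen, so the bound [L] below does not depend on the cube;
   the maximum with 0 makes them nonnegative. *)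
have /choice[K HK] : forall al : multi_index N m, exists k : R, 0 <= k /\
    ((1 <= mi_size al <= m)%N -> \forall r \near +oo,
     ((\prod_(i < N) F i r ^- (al i : nat))%:E *
      (\int[mu]_(x in shell (F ^~ r) (fun i => al i))
         (`|a al x| `^ q * th x `^ (- (q - 1)))%:E) `^ q^-1 <= k%:E)%E).
  move=> al.
  have [alm|] := boolP (1 <= mi_size al <= m)%N; last by exists 0.
  have [k Hk] := HG al alm; exists (Num.max 0 k); split.
    by rewrite le_max lexx.
  move=> _; apply: filterS Hk => r /le_trans; apply.
  by rewrite lee_fin le_max lexx orbT.
have K0 al : 0 <= K al by case: (HK al).
have w_eq0 : (\int[mu]_x (w x)%:E = 0)%E.
  pose L :=
    \sum_(al : multi_index N m | (1 <= mi_size al <= m)%N) C ^+ N * K al.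
  have mD n : measurable (@cube R N n%:R) by exact: measurable_cube.
  apply: (@integral_eq0_of_selfimproving _ _ _ mu p L w
    (fun n => cube n%:R)) => //.
  - by apply: sumr_ge0 => al _; rewrite mulr_ge0 ?exprn_ge0.
  - move=> i j ij; apply/subsetPset => x xi k.
    by apply: le_trans (xi k) _; rewrite ler_nat.
  - apply/seteqP; split => // x _.
    exists (Num.bound (\sum_k `|tnth x k|)) => // k.
    apply: le_trans (ltW (archi_boundP _)); last by rewrite sumr_ge0.
    by rewrite (bigD1 k)//= lerDl sumr_ge0.
  move=> n.
  (* For large r every cutoff factor is 1 on the cube of half-side n, and the finitely many bounds
     hold at once. *)
  have [r [r0 rF rK]] : exists r, [/\ 0 < r, forall k, n%:R < F k r / 2 &
      forall al : multi_index N m, (1 <= mi_size al <= m)%N ->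
      ((\prod_(i < N) F i r ^- (al i : nat))%:E *
      (\int[mu]_(x in shell (F ^~ r) (fun i => al i))
         (`|a al x| `^ q * th x `^ (- (q - 1)))%:E) `^ q^-1 <= (K al)%:E)%E].
    apply: (@filter_ex _ (+oo)).
    near=> r; split.
    + by near: r; exact: nbhs_pinfty_gt.
    + near: r; apply: filter_forall => k.
      have /cvgryPgt/(_ (n%:R * 2)) := Fy k.
      by apply: filterS => r; rewrite ltr_pdivlMr.
    + near: r; apply: filter_forall => al.
      have [alm|] := boolP (1 <= mi_size al <= m)%N; last first.
        by move=> _; apply: nearW.
      by apply: filterS ((HK al).2 alm).
  pose c k := F k r.
  have c0 k : 0 < c k by exact: F0.
  pose phi := tensor W c (fun=> 0%N).
  have phi01 x : 0 <= phi x <= 1 by exact: tensor01.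
  have mphi : measurable_fun setT phi by exact: measurable_tensor.
  have tphi : test_fun phi.
    by apply: test_fun_tensor => // t t1; exact: (supp 0%N).
  have mwphi : measurable_fun setT (fun x => (w x * phi x)%:E).
    by apply/measurable_EFinP; exact: measurable_funM.
  have wphi0 x : (0 <= (w x * phi x)%:E)%E.
    by rewrite lee_fin mulr_ge0//; case/andP: (phi01 x).
  exists phi; split => //.
  - by move=> x xn; apply: tensor_eq1 xn => // k; exact/ltW/rF.
  (* Finiteness comes from the local integrability of f g |u|^p, since phi vanishes outside a
     cube. *)
  - have [_ [M phiM]] := tphi.
    have /integrableP[_] := iw M; apply: le_lt_trans.
    rewrite (_ : (\int[mu]_x (w x * phi x)%:E =
        \int[mu]_(x in cube M) (w x * phi x)%:E)%E); last first.
      rewrite [RHS]integral_mkcond; apply: eq_integral => x _.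
      rewrite patchE; case: ifPn => // /negP xM; rewrite phiM ?mulr0//.
      apply: contrapT => /forallNP xM'; apply: xM; apply/mem_set => k.
      by rewrite leNgt; apply/negP; exact: xM'.
    apply: ae_ge0_le_integral => //.
    + exact: measurable_cube.
    + exact: measurable_funTS.
    + apply: (measurableT_comp (f := abse)) => //; apply: measurable_funTS.
      exact/measurable_EFinP.
    apply: filterS th0 => x th0 _; rewrite /= lee_fin.
    rewrite (mulrC (f x)) normrM (ger0_norm (powR_ge0 _ _)) ler_piMr//.
    by case/andP: (phi01 x).
  move=> B HB.
  have mB : measurable B.
    by case: HB => ->; [exact: measurableT|exact: measurableC].
  (* Since alpha is nonzero, some coordinate on its shell satisfies |x_k| >= F_k(r)/2 > n, so the
     shell misses the cube. *)
  have SB (al : multi_index N m) : (1 <= mi_size al <= m)%N ->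
      shell c (fun i => al i) `<=` B.
    move=> /andP[al1 _] x xs; case: HB => -> // xn.
    have [k alk] : exists k, al k != 0%N :> nat.
      apply/existsP; rewrite -negb_forall; apply/negP => /forallP al0.
      by move: al1; rewrite /mi_size big1// => k _; exact/eqP.
    have := (xs k).2 alk; have := xn k; have := rF k; rewrite -/(c k).
    by move=> h1 h2 h3; have := lt_le_trans h1 (le_trans h3 h2); rewrite ltxx.
  apply: le_trans (le_integral_diff_op_tensor m mu p q C W c a u th K B
    p0 q0 pq C0 sW W01 c0 supp bnd mu_ mth ma th0 mB _); last first.
    by move=> al alm; split; [exact: SB|exact: rK].
  (* The equation for u turns the left side into the integral of u D^* phi. *)
  have -> : (\int[mu]_x (w x * phi x)%:E =
      `|\int[mu]_x (u x * diff_op 1 a phi x)%:E|)%E.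
    rewrite -sol// -[LHS]gee0_abs ?integral_ge0//; congr (`| _ |)%E.
    apply: ae_eq_integral => //.
      by apply/measurable_EFinP; exact: measurable_funM.
    apply: filterS th0 => x th0 _.
    by rewrite /w gtr0_norm// /th (mulrC (g x)).
  apply: le_abse_integral => //.
  apply/measurable_EFinP; apply: measurable_funM => //.
  rewrite /diff_op; under eq_fun do rewrite -big_filter.
  apply: measurable_sum => al; apply: measurable_funM => //.
  by rewrite dalpha_tensor//; exact: measurable_tensor.
have : ae_eq mu setT (EFin \o w) (cst 0%E).
  apply/ae_eq_integral_abs => //; first exact/measurable_EFinP.
  by rewrite -[RHS]w_eq0; apply: eq_integral => x _ /=; rewrite ger0_norm.
(* Where w = 0 and th > 0, the power |u|^p vanishes, hence u does. *)
move=> aew; apply: filterS2 th0 aew => x th0 /(_ I)/= [] /eqP.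
rewrite mulf_eq0 normr_eq0 gt_eqF//= powR_eq0 normr_eq0 => /andP[/eqP ->].
by [].
Unshelve. all: by end_near.
Qed.
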